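(* Let $p$ be a prime number and $d=d_1\cdots d_n=p^n$ with $d_r=p$ for $r=1,\ldots,n$. Suppose given a set of $p+1$ pairwise mutually unbiased product bases of $\mathbb{C}^d=(\mathbb{C}^p)^{\otimes n}$, such that each of these product bases contains at least one orthogonal set of $d_r=p$ vectors in each subsystem $\mathbb{C}^{d_r}$ (that is, for every $r$, among the $r$-th tensor factors of its $d$ basis vectors there are $p$ mutually orthogonal ones). Then any unit vector $|\mu\rangle\in\mathbb{C}^d$ which is mutually unbiased to all of these $p+1$ bases is maximally entangled across all bipartitions $\mathbb{C}^{p}\otimes\mathbb{C}^{p^{n-1}}$ (the $n$ bipartitions separating one factor $\mathbb{C}^p$ from the remaining $n-1$ factors).
   Context: A product basis of $\mathbb{C}^{d_1}\otimes\cdots\otimes\mathbb{C}^{d_n}$ is an orthonormal basis each of whose vectors is a tensor product $|\psi^1\rangle\otimes\cdots\otimes|\psi^n\rangle$ with $|\psi^r\rangle\in\mathbb{C}^{d_r}$. It need not be a tensor product of bases of the factors. Two orthonormal bases $\{|a_i\rangle\}$, $\{|b_j\rangle\}$ of $\mathbb{C}^d$ are mutually unbiased if $|\langle a_i|b_j\rangle|^2=1/d$ for all $i,j$. A unit vector $|\mu\rangle$ is mutually unbiased to a basis $\{|a_i\rangle\}$ of $\mathbb{C}^d$ if $|\langle a_i|\mu\rangle|^2=1/d$ for all $i$. A unit vector $|\mu\rangle$ is maximally entangled across the bipartition separating the $r$-th factor $\mathbb{C}^p$ from the other factors if its reduced density matrix on the $r$-th factor (the partial trace of $|\mu\rangle\langle\mu|$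 over all other factors) equals $\frac{1}{p}\mathbb{1}$. *)

(* Defs.v *)
From HB Require Import structures.
From mathcomp Require Import all_boot all_order all_algebra.

Set Implicit Arguments.
Unset Strict Implicit.
Unset Printing Implicit Defensive.

Import Order.TTheory GRing.Theory Num.Theory.
Local Open Scope ring_scope.

(* The Hilbert space C^I of dimension #|I|, in coordinates. The complex numbers
   are the instance C = R[i] with R : realType. *)
Definition hvec (C : numClosedFieldType) (I : finType) := {ffun I -> C}.

(* The n-fold tensor power of C^p, in coordinates for the standard product
   basis, whose index set is {ffun 'I_n -> 'I_p}. *)
Definition tvec (C : numClosedFieldType) (p n : nat) :=
  hvec C {ffun 'I_n -> 'I_p}.

Section Definitions.
Variable C : numClosedFieldType.

Definition hdot (I : finType) (u v : hvec C I) : C :=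
  \sum_(x : I) (u x)^* * v x.

Definition unit_vector (I : finType) (u : hvec C I) : Prop := hdot u u = 1.

(* {ffun I -> C^o}, convertible to hvec C I, carries the vectType structure. *)
Definition orthonormal_basis (I J : finType) (b : J -> hvec C I) : Prop :=
  (forall i j, hdot (b i) (b j) = (i == j)%:R) /\
  basis_of {: {ffun I -> C^o}} [seq (b j : {ffun I -> C^o}) | j : J].

Definition mutually_unbiased (I J K : finType)
    (a : J -> hvec C I) (b : K -> hvec C I) : Prop :=
  forall j k, `|hdot (a j) (b k)| ^+ 2 = #|I|%:R^-1.

Definition unbiased_to (I J : finType)
    (mu : hvec C I) (a : J -> hvec C I) : Prop :=
  forall j, `|hdot (a j) mu| ^+ 2 = #|I|%:R^-1.

Variables p n : nat.

Definition tensor (psi : 'I_n -> hvec C 'I_p) : tvec C p n :=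
  [ffun x : {ffun 'I_n -> 'I_p} => \prod_(r < n) psi r (x r)].

Definition product_basis (J : finType) (b : J -> tvec C p n) : Prop :=
  orthonormal_basis b /\ forall j, exists psi, b j = tensor psi.

(* Tensor factors of a nonzero product vector are determined up to nonzero
   scalars, so the choice of the factors phi is immaterial. The indices k j are
   automatically distinct, as a nonzero factor is not orthogonal to itself. *)
Definition has_orthogonal_factors (J : finType) (b : J -> tvec C p n)
    (r : 'I_n) : Prop :=
  exists (k : 'I_p -> J) (phi : 'I_p -> 'I_n -> hvec C 'I_p),
    (forall j, b (k j) = tensor (phi j)) /\
    (forall i j, i != j -> hdot (phi i r) (phi j r) = 0).

(* Entries of |mu><mu|. *)
Definition ketbra (I : finType) (mu : hvec C I) (x y : I) : C :=
  mu x * (mu y)^*.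

Definition set_coord (x : {ffun 'I_n -> 'I_p}) (r : 'I_n) (j : 'I_p) :
    {ffun 'I_n -> 'I_p} :=
  [ffun s => if s == r then j else x s].

(* Partial trace over all factors but the r-th: the multi-indices x with
   x r = i stand for the joint indices of the other factors. *)
Definition partial_trace (r : 'I_n)
    (rho : {ffun 'I_n -> 'I_p} -> {ffun 'I_n -> 'I_p} -> C) : 'M[C]_p :=
  \matrix_(i, j) \sum_(x : {ffun 'I_n -> 'I_p} | x r == i)
    rho x (set_coord x r j).

(* Maximal entanglement, for a unit vector mu, across the bipartition
   separating the r-th factor from the others. *)
Definition maximally_entangled (mu : tvec C p n) (r : 'I_n) : Prop :=
  partial_trace r (ketbra mu) = p%:R^-1 *: 1%:M.

End Definitions.

(* Main.v *)
Require Import Defs.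
From HB Require Import structures.
From mathcomp Require Import all_boot all_order all_algebra.
From mathcomp Require Import complex.
From mathcomp Require Import reals.
From mathcomp Require Import ring.

Set Implicit Arguments.
Unset Strict Implicit.
Unset Printing Implicit Defensive.

Import Order.TTheory GRing.Theory Num.Theory.
Local Open Scope ring_scope.

(* A product vector unbiased to a product basis is unbiased to it factor by
   factor, so the orthogonal r-th factors of the p+1 given bases form a complete
   set of p+1 mutually unbiased bases of C^p. A unit vector unbiased to p of these
   belongs, up to a phase, to the remaining one; hence for each basis every r-th
   factor is one of p orthonormal vectors phi_j, each occurring p^(n-1) times, and
   <phi_j|rho_r|phi_j> = p^(n-1) / p^n = 1/p for the reduced density matrix rho_r
   of mu. A complete set of mutually unbiased bases being informationally
   complete, rho_r = 1/p. *)

(** * Inner products and orthonormal expansions in coordinates *)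

Section InnerProduct.
Variables (C : numClosedFieldType) (I : finType).
Implicit Types u v : hvec C I.

Lemma hdotC u v : hdot v u = (hdot u v)^*.
Proof.
rewrite /hdot rmorph_sum; apply: eq_bigr => x _.
by rewrite rmorphM /= conjCK mulrC.
Qed.

Lemma hdotZl c u v : hdot [ffun x => c * u x] v = c^* * hdot u v.
Proof.
by rewrite /hdot mulr_sumr; apply: eq_bigr => x _; rewrite ffunE rmorphM /= mulrA.
Qed.

Lemma hdotZr c u v : hdot u [ffun x => c * v x] = c * hdot u v.
Proof. by rewrite hdotC hdotZl [hdot v u]hdotC rmorphM /= !conjCK. Qed.

Lemma hdot_normE u : hdot u u = \sum_x `|u x| ^+ 2.
Proof. by apply: eq_bigr => x _; rewrite mulrC normCK. Qed.

Lemma hdot_ge0 u : 0 <= hdot u u.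
Proof. by rewrite hdot_normE sumr_ge0 // => x _; rewrite exprn_ge0. Qed.

Lemma orthonormal_expand (J : finType) (b : J -> hvec C I) v x :
  orthonormal_basis b -> v x = \sum_j hdot (b j) v * b j x.
Proof.
case=> bon /andP[/eqP bspan _].
pose X := in_tuple [seq (b j : {ffun I -> C^o}) | j : J].
have vX : (v : {ffun I -> C^o}) \in <<X>>%VS by rewrite /X /= bspan memvf.
have [c vE] : exists c : J -> C, forall x, v x = \sum_j c j * b j x.
  move: vX; rewrite span_def big_map big_enum => /memv_sumP [w wP ->].
  have /(fin_all_exists (P := fun j c => w j = c *: (b j : {ffun I -> C^o}))) [c cP] :
      forall j, exists c : C, w j = c *: (b j : {ffun I -> C^o}).
    by move=> j; apply/vlineP; apply: wP.
  exists c => y; rewrite sum_ffunE; apply: eq_bigr => j _.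
  by rewrite cP ffunE.
have cE j : hdot (b j) v = c j.
  rewrite /hdot; under eq_bigr do rewrite vE mulr_sumr.
  rewrite exchange_big (bigD1 j) //= [X in _ + X]big1 ?addr0 => [|k kj].
    transitivity (c j * hdot (b j) (b j)); last by rewrite bon eqxx mulr1.
    by rewrite mulr_sumr; apply: eq_bigr => y _; rewrite mulrCA.
  transitivity (c k * hdot (b j) (b k)).
    by rewrite mulr_sumr; apply: eq_bigr => y _; rewrite mulrCA.
  by rewrite bon eq_sym (negPf kj) mulr0.
by rewrite vE; apply: eq_bigr => j _; rewrite cE.
Qed.

Lemma parseval (J : finType) (b : J -> hvec C I) v :
  orthonormal_basis b -> \sum_j `|hdot (b j) v| ^+ 2 = hdot v v.
Proof.
move=> bon; rewrite [RHS]/hdot.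
under [RHS]eq_bigr do rewrite [X in _ * X](orthonormal_expand v _ bon) mulr_sumr.
rewrite exchange_big; apply: eq_bigr => j _.
rewrite normCK -hdotC mulr_sumr; apply: eq_bigr => x _; ring.
Qed.

End InnerProduct.

Lemma psumr2_eq0 (C : numDomainType) (I J : finType) (F : I -> J -> C) :
  (forall i j, 0 <= F i j) -> \sum_i \sum_j F i j = 0 -> forall i j, F i j = 0.
Proof.
move=> F_ge0 F0 i j.
have Fi0 : \sum_j F i j = 0.
  by apply: (psumr_eq0P _ F0) => // k _; apply: sumr_ge0.
by apply: (psumr_eq0P _ Fi0).
Qed.

(** * Reconstruction of operators from complete sets of mutually unbiased bases *)

Section MutuallyUnbiasedTomography.
Variables (C : numClosedFieldType) (p : nat).
Hypothesis p_gt0 : (0 < p)%N.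

Definition adjmx (A : 'M[C]_p) : 'M[C]_p := \matrix_(x, y) (A y x)^*.

Lemma mxtrace_adj_mul (A : 'M[C]_p) :
  \tr (adjmx A *m A) = \sum_x \sum_y `|A y x| ^+ 2.
Proof.
apply: eq_bigr => x _; rewrite mxE; apply: eq_bigr => y _.
by rewrite mxE normCKC.
Qed.

Lemma mxtrace_adj_eq0 (A : 'M[C]_p) : \tr (adjmx A *m A) = 0 -> A = 0.
Proof.
rewrite mxtrace_adj_mul => A0; apply/matrixP => y x; rewrite mxE.
have := psumr2_eq0 (fun x y => exprn_ge0 2 (normr_ge0 (A y x))) A0 x y.
by move/eqP; rewrite sqrf_eq0 normr_eq0 => /eqP.
Qed.

Section Reconstruction.
Variable P : 'I_p.+1 -> 'I_p -> 'M[C]_p.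
Hypothesis P_adj : forall a j, adjmx (P a j) = P a j.
Hypothesis P_sum : forall a, \sum_j P a j = 1%:M.
Hypothesis P_tr : forall a b i j,
  \tr (P a i *m P b j) = if a == b then (i == j)%:R else p%:R^-1.

(** The error of the tomographic formula that recovers [M] as the sum of the [P a j] weighted by
    [\tr (P a j *m M)], minus [\tr M] times the identity. *)
Definition residual (M : 'M[C]_p) : 'M[C]_p :=
  M - \sum_a \sum_j \tr (P a j *m M) *: P a j + \tr M *: 1%:M.

Let p_neq0 : p%:R != 0 :> C. Proof. by rewrite pnatr_eq0 -lt0n. Qed.

Let trP a j : \tr (P a j) = 1.
Proof.
rewrite -[P a j]mulmx1 -(P_sum a) mulmx_sumr raddf_sum /= (bigD1 j) //= P_tr !eqxx.
by rewrite big1 ?addr0 // => k kj; rewrite P_tr eqxx eq_sym (negPf kj).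
Qed.

Lemma residual_sym M N : \tr (M *m residual N) = \tr (residual M *m N).
Proof.
rewrite /residual !mulmxDr !mulmxDl !mulmxN !mulNmx !raddfD /= !raddfN /=.
rewrite -!scalemxAl -!scalemxAr mulmx1 mul1mx !mxtraceZ [\tr N * _]mulrC.
congr (_ - _ + _).
rewrite mulmx_sumr mulmx_suml !raddf_sum; apply: eq_bigr => a _ /=.
rewrite mulmx_sumr mulmx_suml !raddf_sum; apply: eq_bigr => j _ /=.
by rewrite -scalemxAl -scalemxAr !mxtraceZ mulrC (mxtrace_mulC M).
Qed.

(** Basis [b] returns [P b k]; each of the [p] other bases contributes [1/p] times the identity, and
    together they cancel the trace term. *)
Lemma residual_proj b k : residual (P b k) = 0.
Proof.
rewrite /residual trP scale1r (bigD1 b) //=.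
have -> : \sum_j \tr (P b j *m P b k) *: P b j = P b k.
  rewrite (bigD1 k) //= P_tr !eqxx scale1r big1 ?addr0 // => j jk.
  by rewrite P_tr eqxx (negPf jk) scale0r.
rewrite (eq_bigr (fun=> p%:R^-1 *: 1%:M)) => [|a ab]; last first.
  rewrite -(P_sum a) scaler_sumr; apply: eq_bigr => j _.
  by rewrite P_tr (negPf ab).
rewrite sumr_const cardC1 card_ord -scaler_nat scalerA mulfV // scale1r.
by rewrite opprD addrA subrr add0r addNr.
Qed.

(** The [p+1] resolutions of the identity exceed the trace term, [p] times the identity, by exactly
    one. *)
Lemma residual1 : residual 1%:M = 0.
Proof.
rewrite /residual mxtrace1.
under eq_bigr => a _ do [under eq_bigr do rewrite mulmx1 trP scale1r; rewrite P_sum].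
by rewrite sumr_const card_ord mulrS -scaler_nat opprD addrA subrr add0r addNr.
Qed.

(** By symmetry, the trace of [residual M] against each [P a j] and against 1 vanishes, so a second
    application subtracts and adds nothing. *)
Lemma residual_idem M : residual (residual M) = residual M.
Proof.
rewrite {1}/residual big1 => [|a _].
  by rewrite -[X in \tr X]mul1mx residual_sym residual1 mul0mx mxtrace0 scale0r subr0 addr0.
by rewrite big1 // => j _; rewrite residual_sym residual_proj mul0mx mxtrace0 scale0r.
Qed.

Lemma residual_adj M : adjmx (residual M) = residual (adjmx M).
Proof.
have trC A : \tr (adjmx A) = (\tr A)^*.
  by rewrite rmorph_sum; apply: eq_bigr => x _; rewrite mxE.
have adjM A B : adjmx (A *m B) = adjmx B *m adjmx A.
  apply/matrixP => x y; rewrite !mxE rmorph_sum; apply: eq_bigr => z _.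
  by rewrite !mxE rmorphM mulrC.
apply/matrixP => x y; rewrite !mxE trC !summxE !rmorphD /= rmorphN rmorph_sum /= rmorphM /=.
congr (_ - _ + _ * _); last by rewrite rmorph_nat eq_sym.
apply: eq_bigr => a _; rewrite !summxE rmorph_sum; apply: eq_bigr => j _.
rewrite !mxE rmorphM /= -trC adjM P_adj mxtrace_mulC; congr (_ * _).
by rewrite -{2}P_adj mxE.
Qed.

(* [residual] is an orthogonal projection on 'M_p, of trace
   p^2 - (p+1)p + p = 0. *)
Lemma residual_eq0 M : residual M = 0.
Proof.
have trd x y (A : 'M[C]_p) : \tr (delta_mx y x *m A) = A x y.
  rewrite mxtrace_mulC /mxtrace (bigD1 x) //= mxE (bigD1 y) //= mxE !eqxx mulr1.
  rewrite !big1 ?addr0 // => z zx; rewrite ?mxE ?big1 ?(negPf zx) ?mulr0 //.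
  by move=> w _; rewrite mxE (negPf zx) andbF mulr0.
have trE x y : \tr (delta_mx y x *m residual (delta_mx x y)) =
    1 - \sum_a \sum_j (P a j x y * P a j y x) + (x == y)%:R.
  rewrite trd /residual !mxE mulr_natr.
  rewrite summxE; congr (_ - _ + _).
  - by rewrite !eqxx.
  - apply: eq_bigr => a _; rewrite summxE; apply: eq_bigr => j _.
    by rewrite mxtrace_mulC trd mxE mulrC.
  - by rewrite -[delta_mx x y]mulmx1 trd mxE (eq_sym y) -mulrnA mulnb andbb.
(* Self-adjointness and idempotence turn these squared Hilbert-Schmidt norms into diagonal
   coefficients of [residual] on the matrix units, so their sum is its trace. *)
have sum0 : \sum_x \sum_y \tr (adjmx (residual (delta_mx x y)) *m residual (delta_mx x y)) = 0.
  have adjd x y : adjmx (delta_mx x y) = delta_mx y x.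
    by apply/matrixP => z w; rewrite !mxE rmorph_nat andbC.
  under eq_bigr => x _ do under eq_bigr => y _ do
    rewrite residual_adj -residual_sym residual_idem adjd trE.
  under eq_bigr do rewrite big_split sumrB /=.
  rewrite big_split sumrB /=.
  (* Each of the [p(p+1)] matrices [P a j] has a square of trace 1. *)
  have -> : \sum_x \sum_y \sum_a \sum_j P a j x y * P a j y x = p%:R * p.+1%:R.
    under eq_bigr do rewrite exchange_big; rewrite exchange_big.
    transitivity (\sum_(a < p.+1) \sum_(j < p) \tr (P a j *m P a j)).
      apply: eq_bigr => a _; under eq_bigr do rewrite exchange_big.
      rewrite exchange_big; apply: eq_bigr => j _; apply: eq_bigr => x _.
      by rewrite mxE.
    under eq_bigr do under eq_bigr do rewrite P_tr !eqxx.
    by rewrite !sumr_const !card_ord -!natrM -mulrnA.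
  have -> : \sum_(x < p) \sum_(y < p) (x == y)%:R = p%:R :> C.
    rewrite (eq_bigr (fun=> 1)) ?sumr_const ?card_ord // => x _.
    by rewrite (bigD1 x) //= eqxx big1 ?addr0 // => y; rewrite eq_sym => /negPf->.
  rewrite !sumr_const !card_ord mulrSr; ring.
have E0 x y : residual (delta_mx x y) = 0.
  apply: mxtrace_adj_eq0; apply: psumr2_eq0 sum0 x y => x y.
  by rewrite mxtrace_adj_mul; do 2![apply: sumr_ge0 => ? _]; rewrite exprn_ge0.
by apply/matrixP => x y; rewrite -trd residual_sym E0 mul0mx mxtrace0 mxE.
Qed.
End Reconstruction.

Definition proj (u : hvec C 'I_p) : 'M[C]_p := \matrix_(x, y) (u x * (u y)^*).

Lemma adjmx_proj u : adjmx (proj u) = proj u.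
Proof. by apply/matrixP => x y; rewrite !mxE rmorphM /= conjCK mulrC. Qed.

Lemma mxtrace_proj u : \tr (proj u) = hdot u u.
Proof. by apply: eq_bigr => x _; rewrite mxE mulrC. Qed.

Lemma mxtrace_proj_mul u v : \tr (proj u *m proj v) = `|hdot u v| ^+ 2.
Proof.
rewrite normCKC -hdotC /hdot mulr_suml; apply: eq_bigr => x _.
rewrite mxE mulr_sumr; apply: eq_bigr => y _; rewrite !mxE; ring.
Qed.

Lemma sum_proj_orthonormal (u : 'I_p -> hvec C 'I_p) :
  (forall i j, hdot (u i) (u j) = (i == j)%:R) -> \sum_j proj (u j) = 1%:M.
Proof.
move=> uon.
(* A one-sided inverse of a square matrix is two-sided, so orthonormality of [p] vectors gives
   completeness. *)
have /mulmx1C UU : (\matrix_(j, x) (u j x)^*) *m (\matrix_(x, j) u j x) = 1%:M :> 'M[C]_p.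
  by apply/matrixP => i j; rewrite !mxE -uon; apply: eq_bigr => x _; rewrite !mxE.
rewrite -UU; apply/matrixP => x y; rewrite !mxE summxE.
by apply: eq_bigr => j _; rewrite !mxE.
Qed.

Section CompleteMUB.
Variable phi : 'I_p.+1 -> 'I_p -> hvec C 'I_p.
Hypothesis phi_on : forall a i j, hdot (phi a i) (phi a j) = (i == j)%:R.
Hypothesis phi_mub : forall a b, a != b -> mutually_unbiased (phi a) (phi b).

Lemma residual_phi_eq0 M : residual (fun a j => proj (phi a j)) M = 0.
Proof.
apply: residual_eq0 => [a j|a|a b i j]; first exact: adjmx_proj.
  exact: sum_proj_orthonormal.
rewrite mxtrace_proj_mul; case: eqVneq => [->|/phi_mub ->].
  by rewrite phi_on normr_nat -natrX; case: (i == j).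
by rewrite card_ord.
Qed.

(** The projections of one basis sum to the identity, so [\tr M] vanishes too, and nothing is left
    in the reconstruction formula. *)
Lemma mub_informationally_complete M :
  (forall a j, \tr (proj (phi a j) *m M) = 0) -> M = 0.
Proof.
move=> M0.
have trM : \tr M = 0.
  rewrite -(mul1mx M) -(sum_proj_orthonormal (phi_on ord0)) mulmx_suml raddf_sum.
  by rewrite big1 // => j _; apply: M0.
rewrite -(residual_phi_eq0 M) /residual trM scale0r addr0 big1 ?subr0 // => a _.
by rewrite big1 // => j _; rewrite M0 scale0r.
Qed.

(* A unit vector unbiased to all but one of p+1 mutually unbiased bases belongs,
   up to a phase, to the remaining one: hence [c := hdot (phi a j) psi] has
   modulus 0 or 1, and the projection of psi on [phi a j] is 0 or psi. *)
Lemma unbiased_to_other_bases a psi :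
    hdot psi psi = 1 -> (forall b, b != a -> unbiased_to psi (phi b)) ->
  forall j x, hdot (phi a j) psi * phi a j x = `|hdot (phi a j) psi| ^+ 2 * psi x.
Proof.
move=> psi1 psi_unb j x.
(* In the reconstruction of [proj psi], the [p] bases unbiased to [psi] sum to the identity and
   cancel the trace term; only basis [a] remains. *)
have projE : proj psi = \sum_i `|hdot (phi a i) psi| ^+ 2 *: proj (phi a i).
  have /eqP := residual_phi_eq0 (proj psi).
  rewrite /residual mxtrace_proj psi1 scale1r (bigD1 a) //=.
  have -> : \sum_(b | b != a) \sum_i \tr (proj (phi b i) *m proj psi) *: proj (phi b i)
            = 1%:M.
    rewrite (eq_bigr (fun=> p%:R^-1 *: 1%:M)) => [|b ba]; last first.
      rewrite -(sum_proj_orthonormal (phi_on b)) scaler_sumr; apply: eq_bigr => i _.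
      by rewrite mxtrace_proj_mul psi_unb // card_ord.
    rewrite sumr_const cardC1 card_ord -scaler_nat scalerA mulfV ?scale1r //.
    by rewrite pnatr_eq0 -lt0n.
  rewrite opprD addrA subrK subr_eq0 => /eqP ->.
  by apply: eq_bigr => i _; rewrite mxtrace_proj_mul.
set c := hdot (phi a j) psi.
(* Both sides of [projE] are applied to the vector [phi a j]. *)
have rel y : psi y * c^* = `|c| ^+ 2 * phi a j y.
  have : \sum_z proj psi y z * phi a j z =
         \sum_z (\sum_i `|hdot (phi a i) psi| ^+ 2 *: proj (phi a i)) y z * phi a j z.
    by rewrite -projE.
  have -> : \sum_z proj psi y z * phi a j z = psi y * c^*.
    rewrite -hdotC mulr_sumr; apply: eq_bigr => z _; rewrite mxE; ring.
  move=> ->.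
  transitivity (\sum_i `|hdot (phi a i) psi| ^+ 2 * phi a i y * hdot (phi a i) (phi a j)).
    under eq_bigr do rewrite summxE mulr_suml.
    rewrite exchange_big; apply: eq_bigr => i _; rewrite mulr_sumr.
    apply: eq_bigr => z _; rewrite !mxE; ring.
  rewrite (bigD1 j) //= phi_on eqxx mulr1 big1 ?addr0 // => i ij.
  by rewrite phi_on (negPf ij) mulr0.
(* Pairing [rel] with [psi] forces the modulus of [c] to be 0 or 1. *)
have relc : c^* = `|c| ^+ 2 * c^*.
  rewrite -{1}[c^*]mul1r -psi1 -{2}hdotC /hdot mulr_suml mulr_sumr.
  by apply: eq_bigr => y _; rewrite -mulrA rel; ring.
have cE : c = `|c| ^+ 2 * c.
  have c2_real : `|c| ^+ 2 \is Num.real by rewrite rpredX ?normr_real.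
  by apply: (inv_inj (@conjCK C)); rewrite rmorphM /= (CrealP c2_real).
by rewrite [in LHS]cE mulrAC -rel normCK; ring.
Qed.

End CompleteMUB.
End MutuallyUnbiasedTomography.

(** * Factors of product vectors and reduced density matrices *)

Section TensorFactors.
Variables (C : numClosedFieldType) (p n : nat).
Implicit Types psi m : 'I_n -> hvec C 'I_p.

Lemma hdot_tensor psi m :
  hdot (tensor psi) (tensor m) = \prod_s hdot (psi s) (m s).
Proof.
rewrite [RHS]bigA_distr_bigA; apply: eq_bigr => x _.
by rewrite !ffunE rmorph_prod -big_split.
Qed.

(** The squared norms of the factors multiply to 1, so dividing each factor by its norm leaves the
    tensor product unchanged. *)
Lemma tensor_normalize psi : hdot (tensor psi) (tensor psi) = 1 ->
  exists c : 'I_n -> C, let psi' s : hvec C 'I_p := [ffun x => c s * psi s x] in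
    tensor psi' = tensor psi /\ (forall s, hdot (psi' s) (psi' s) = 1).
Proof.
rewrite hdot_tensor => psi1; pose N s := hdot (psi s) (psi s).
have N_neq0 s : N s != 0.
  apply/eqP => Ns0; move/eqP: psi1; rewrite (bigD1 s) //= -/(N s) Ns0 mul0r eq_sym.
  by rewrite oner_eq0.
exists (fun s => (sqrtC (N s))^-1); split=> [|s].
  apply/ffunP => x; rewrite !ffunE; under eq_bigr do rewrite ffunE.
  rewrite big_split /= -[RHS]mul1r; congr (_ * _); rewrite prodfV.
  suff -> : \prod_s sqrtC (N s) = 1 by rewrite invr1.
  apply/eqP; rewrite -(@pexpr_eq1 _ _ 2) //; last first.
    by rewrite prodr_ge0 // => s _; rewrite sqrtC_ge0 hdot_ge0.
  by rewrite -prodrXl; under eq_bigr do rewrite sqrtCK; rewrite psi1.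
rewrite hdotZl hdotZr mulrA -normCKC normfV exprVn.
by rewrite -normrX sqrtCK ger0_norm ?hdot_ge0 // mulVf.
Qed.

(** At an index [k i] the factors are taken from [phi i], so that the [r]-th ones stay orthogonal
    after normalization; at any other index an arbitrary factorization serves. *)
Lemma adapted_factors (J : finType) (b : J -> tvec C p n) r :
    product_basis b -> has_orthogonal_factors b r ->
  exists (psi : J -> 'I_n -> hvec C 'I_p) (k : 'I_p -> J),
    [/\ forall j, b j = tensor (psi j),
        forall j s, hdot (psi j s) (psi j s) = 1
      & forall i j, hdot (psi (k i) r) (psi (k j) r) = (i == j)%:R].
Proof.
move=> [[bon _] bprod] [k [phi [bk phi_orth]]].
(* If the indices coincided, an inner product equal to 1 would contain the vanishing factor at
   [r]. *)
have k_inj i j : k i = k j -> i = j.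
  move=> kij; apply/eqP; apply: contraT => ij.
  have := bon (k i) (k j); rewrite {1}bk {1}bk hdot_tensor kij eqxx (bigD1 r) //=.
  by rewrite phi_orth // mul0r => /esym/eqP; rewrite oner_eq0.
have [psi psiP] : exists psi : J -> 'I_n -> hvec C 'I_p, forall j,
    [/\ b j = tensor (psi j), forall s, hdot (psi j s) (psi j s) = 1
      & forall i, k i = j -> exists c, psi j r = [ffun x => c * phi i r x]].
  apply: (fin_all_exists (P := fun j (psi : 'I_n -> hvec C 'I_p) =>
    [/\ b j = tensor psi, forall s, hdot (psi s) (psi s) = 1
      & forall i, k i = j -> exists c, psi r = [ffun x => c * phi i r x]])) => j.
  have norm_j f : b j = tensor f -> hdot (tensor f) (tensor f) = 1.
    by move=> <-; rewrite bon eqxx.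
  have [[i kij]|no_i] := altP (@existsP _ (fun i => k i == j)).
    have bj : b j = tensor (phi i) by rewrite -bk (eqP kij).
    have [c [tc nc]] := tensor_normalize (norm_j _ bj).
    exists (fun s => [ffun x => c s * phi i s x]); split=> //; first by rewrite bj tc.
    by move=> i' ki'; exists (c r); rewrite (k_inj i' i) // ki' (eqP kij).
  have [f bj] := bprod j; have [c [tc nc]] := tensor_normalize (norm_j _ bj).
  exists (fun s => [ffun x => c s * f s x]); split=> //; first by rewrite bj tc.
  by move=> i kij; case/negP: no_i; apply/existsP; exists i; apply/eqP.
exists psi, k; split=> [j|j|i j]; try by have [] := psiP j.
case: eqVneq => [->|ij]; first by have [] := psiP (k j).
have [_ _ /(_ i erefl)[c ->]] := psiP (k i).
have [_ _ /(_ j erefl)[d ->]] := psiP (k j).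
by rewrite hdotZl hdotZr phi_orth // !mulr0.
Qed.

Section UnitFactors.
Variables (J : finType) (psi : J -> 'I_n -> hvec C 'I_p).
Hypothesis psi_basis : orthonormal_basis (fun j => tensor (psi j)).
Hypothesis psi_unit : forall j s, hdot (psi j s) (psi j s) = 1.
Hypothesis J_card : #|J| = (p ^ n)%N.

(* Apply Parseval's identity to the product vectors whose factors are those of m
   in S and standard basis vectors elsewhere. *)
Lemma sum_prod_factors m (S : pred 'I_n) : (forall s, hdot (m s) (m s) = 1) ->
  \sum_j \prod_(s | S s) (p%:R * `|hdot (psi j s) (m s)| ^+ 2) = #|J|%:R.
Proof.
move=> m1; pose e (i : 'I_p) : hvec C 'I_p := [ffun x => (x == i)%:R].
have hdot_e (f : hvec C 'I_p) i : hdot f (e i) = (f i)^*.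
  rewrite /hdot (bigD1 i) //= ffunE eqxx mulr1 big1 ?addr0 // => x xi.
  by rewrite ffunE (negPf xi) mulr0.
pose w (x : {ffun 'I_n -> 'I_p}) s := if S s then m s else e (x s).
have w1 x : hdot (tensor (w x)) (tensor (w x)) = 1.
  rewrite hdot_tensor big1 // => s _; rewrite /w; case: ifP => // _.
  by rewrite hdot_e ffunE eqxx rmorph1.
transitivity (\sum_x hdot (tensor (w x)) (tensor (w x))); last first.
  under eq_bigr do rewrite w1.
  by rewrite sumr_const card_ffun !card_ord J_card.
under [RHS]eq_bigr do rewrite -(parseval _ psi_basis).
rewrite [RHS]exchange_big; apply: eq_bigr => j _ /=.
under [RHS]eq_bigr do rewrite hdot_tensor normr_prod -prodrXl.
rewrite -(bigA_distr_bigA (fun s i =>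
  `|hdot (psi j s) (if S s then m s else e i)| ^+ 2)) /= big_mkcond /=.
(* For [s] in [S] the summand does not depend on [i], whence the factor [p]; otherwise the sum is
   the squared norm of a unit factor. *)
apply: eq_bigr => s _; case: (S s).
  by rewrite [RHS]sumr_const card_ord mulr_natl.
rewrite -(psi_unit j s) hdot_normE; apply: eq_bigr => i _.
by rewrite hdot_e norm_conjC.
Qed.

(* With x_j := p |<psi_j r | m r>|^2 and y_j the product of the same quantities
   over the other factors, x_j y_j = 1, while x and y both have mean 1; so
   sum_j (x_j + y_j - 2) = sum_j (x_j - 1)^2 y_j vanishes. *)
Lemma factor_unbiased m r : (forall s, hdot (m s) (m s) = 1) ->
    unbiased_to (tensor m) (fun j => tensor (psi j)) ->
  forall j, `|hdot (psi j r) (m r)| ^+ 2 = p%:R^-1.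
Proof.
move=> m1 m_unb.
pose c j s : C := p%:R * `|hdot (psi j s) (m s)| ^+ 2.
pose y j := \prod_(s | s != r) c j s.
have c_ge0 j s : 0 <= c j s by rewrite mulr_ge0 ?ler0n ?exprn_ge0.
(* A space containing a unit vector has nonzero dimension. *)
have p_neq0 : p%:R != 0 :> C.
  have [x _] : {x : 'I_p | true}.
    have := m1 r; case: (pickP (@predT 'I_p)) => [x _ _|none]; first by exists x.
    by rewrite /hdot big_pred0 // => /esym/eqP; rewrite oner_eq0.
  by rewrite pnatr_eq0 -lt0n (leq_trans _ (ltn_ord x)).
have cy j : c j r * y j = 1.
  transitivity (\prod_s c j s); first by rewrite (bigD1 r).
  rewrite big_split /= prodr_const card_ord prodrXl -normr_prod -hdot_tensor m_unb card_ffun !card_ord natrX.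
  by rewrite mulfV // expf_neq0.
(* The two means come from taking [S] to be [r] alone, then its complement. *)
have sum_c : \sum_j c j r = #|J|%:R.
  by rewrite -(sum_prod_factors (pred1 r) m1); apply: eq_bigr => j _; rewrite big_pred1_eq.
have sum_y : \sum_j y j = #|J|%:R by apply: (sum_prod_factors (predC1 r) m1).
have sqE j : (c j r - 1) ^+ 2 * y j = c j r + y j - 2.
  have -> : (c j r - 1) ^+ 2 * y j = c j r * (c j r * y j) - (c j r * y j) *+ 2 + y j by ring.
  by rewrite cy; ring.
have sq0 : \sum_j (c j r - 1) ^+ 2 * y j = 0.
  under eq_bigr do rewrite sqE.
  rewrite sumrB big_split /= sum_c sum_y sumr_const; ring.
move=> j.
have /eqP : (c j r - 1) ^+ 2 * y j = 0.
  apply: (psumr_eq0P _ sq0) => // k _; rewrite mulr_ge0 ?prodr_ge0 // real_exprn_even_ge0 //.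
  by rewrite rpredB ?rpred1 // ger0_real.
have y_neq0 : y j != 0.
  by apply/eqP => y0; move/eqP: (cy j); rewrite y0 mulr0 eq_sym oner_eq0.
rewrite mulf_eq0 (negPf y_neq0) orbF sqrf_eq0 subr_eq0 => /eqP cj1.
by rewrite -[LHS](mulKf p_neq0) -/(c j r) cj1 mulr1.
Qed.

End UnitFactors.

(** The operator [|phi><phi|] on the [r]-th factor, tensored with the identity on the others. *)
Definition factor_proj (phi : hvec C 'I_p) (r : 'I_n) (v : tvec C p n) : tvec C p n :=
  [ffun z : {ffun 'I_n -> 'I_p} => phi (z r) * \sum_i (phi i)^* * v (set_coord z r i)].

Lemma mxtrace_proj_partial_trace phi r mu :
  \tr (proj phi *m partial_trace r (ketbra mu)) = hdot (factor_proj phi r mu) mu.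
Proof.
transitivity (\sum_x \sum_(z : {ffun 'I_n -> 'I_p})
    phi x * (phi (z r))^* * (mu z * (mu (set_coord z r x))^*)).
  (* The row index of the partial trace and the multi-indices summed in that entry together range
     over all [z]. *)
  apply: eq_bigr => x _; rewrite mxE (partition_big (fun z : {ffun 'I_n -> 'I_p} => z r) predT) //=.
  apply: eq_bigr => y _; rewrite !mxE mulr_sumr.
  by apply: eq_bigr => z /eqP ->.
rewrite exchange_big; apply: eq_bigr => z _ /=.
rewrite ffunE rmorphM rmorph_sum /= mulr_sumr mulr_suml; apply: eq_bigr => x _.
rewrite rmorphM /= conjCK; ring.
Qed.

Lemma factor_proj_tensor phi r psi z :
  factor_proj phi r (tensor psi) z =
  hdot phi (psi r) * phi (z r) * \prod_(s | s != r) psi s (z s).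
Proof.
rewrite ffunE mulr_sumr /hdot !mulr_suml; apply: eq_bigr => i _.
rewrite ffunE (bigD1 r) //= ffunE eqxx.
rewrite (eq_bigr (fun s => psi s (z s))); first by ring.
by move=> s /negPf sr; rewrite ffunE sr.
Qed.

(** The basis diagonalizes the operator with eigenvalues [q j], so the expectation in [mu] is their
    sum weighted by squared coefficients. Real eigenvalues survive the conjugation of the left
    argument. *)
Lemma hdot_factor_proj (J : finType) (b : J -> tvec C p n) phi r mu (q : J -> C) :
    orthonormal_basis b -> (forall j, q j \is Num.real) ->
    (forall j z, factor_proj phi r (b j) z = q j * b j z) ->
  hdot (factor_proj phi r mu) mu = \sum_j q j * `|hdot (b j) mu| ^+ 2.
Proof.
move=> bon q_real bq.
have E z : factor_proj phi r mu z = \sum_j hdot (b j) mu * q j * b j z.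
  rewrite ffunE; under eq_bigr do rewrite (orthonormal_expand mu _ bon) mulr_sumr.
  rewrite exchange_big mulr_sumr; apply: eq_bigr => j _.
  rewrite -mulrA -bq ffunE !mulr_sumr; apply: eq_bigr => i _; ring.
rewrite {1}/hdot; under eq_bigr do rewrite E rmorph_sum mulr_suml.
rewrite exchange_big; apply: eq_bigr => j _ /=.
rewrite normCKC [in RHS]/hdot 2!mulr_sumr; apply: eq_bigr => z _.
rewrite !rmorphM /= (CrealP (q_real j)); ring.
Qed.

End TensorFactors.

(** * Maximal entanglement of unbiased vectors *)

Theorem lemma6 (R : realType) (p n : nat) (p_prime : prime p) (n_gt0 : (0 < n)%N)
    (B : 'I_p.+1 -> 'I_(p ^ n) -> tvec R[i] p n)
    (B_product : forall a, product_basis (B a))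
    (B_mub : forall a b, a != b -> mutually_unbiased (B a) (B b))
    (B_factors : forall a r, has_orthogonal_factors (B a) r)
    (mu : tvec R[i] p n)
    (mu_unit : unit_vector mu)
    (mu_unbiased : forall a, unbiased_to mu (B a)) :
  forall r : 'I_n, maximally_entangled mu r.
Proof.
move=> r; have p_gt0 := prime_gt0 p_prime.
have p_neq0 : p%:R != 0 :> R[i] by rewrite pnatr_eq0 -lt0n.
have [psi] := fin_all_exists (fun a => adapted_factors (B_product a) (B_factors a r)).
case/fin_all_exists=> k /all_and3[BE psi1 psi_on].
have psi_basis a : orthonormal_basis (fun j => tensor (psi a j)).
  have [[on bas] _] := B_product a; split=> [i j|]; first by rewrite -!BE.
  by rewrite -(eq_image (frefl _) (BE a)).
(* This covers all [r]-th factors, not only those selected by [k]. *)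
have psi_unb a b j l : a != b -> `|hdot (psi a j r) (psi b l r)| ^+ 2 = p%:R^-1.
  move=> ab; apply: (factor_unbiased (psi_basis a) (psi1 a) _ _ (psi1 b l)).
    by rewrite card_ord.
  by move=> i; rewrite -!BE B_mub.
pose phi a j := psi a (k a j) r.
have phi_mub a b : a != b -> mutually_unbiased (phi a) (phi b).
  by move=> ab i j; rewrite psi_unb // card_ord.
rewrite /maximally_entangled; apply/eqP; rewrite -subr_eq0; apply/eqP.
(* It suffices that the reduced density matrix has expectation [1/p] in every [phi a i]. *)
apply: (mub_informationally_complete p_gt0 psi_on phi_mub) => a i.
rewrite mulmxBr raddfB /= -scalemxAr mulmx1 mxtraceZ mxtrace_proj psi_on eqxx mulr1.
rewrite mxtrace_proj_partial_trace.
(* The eigenvalue, 0 or 1, of the projection on [phi a i] in the [r]-th factor at the [j]-th vector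
   of basis [a]. *)
pose q j := `|hdot (phi a i) (psi a j r)| ^+ 2.
rewrite (hdot_factor_proj (q := q) _ (psi_basis a)) => [|j|j z]; first last.
- rewrite factor_proj_tensor (unbiased_to_other_bases p_gt0 psi_on phi_mub) //; last first.
    by move=> b ba l; rewrite psi_unb ?card_ord.
  by rewrite ffunE [in RHS](bigD1 r) //= mulrA.
- by rewrite rpredX ?normr_real.
(* The eigenvalue 1 thus occurs [p^(n-1)] times, while each basis vector carries weight [1/p^n] in
   [mu]. *)
have : \sum_j p%:R * q j = #|'I_(p ^ n)|%:R.
  rewrite -(sum_prod_factors (psi_basis a) (psi1 a) _ (pred1 r) (psi1 a (k a i))) ?card_ord //.
  apply: eq_bigr => j _; rewrite big_pred1_eq; congr (_ * _).
  by rewrite /q hdotC norm_conjC.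
rewrite -mulr_sumr card_ord => sum_q.
under eq_bigr => j _ do rewrite -BE mu_unbiased card_ffun !card_ord.
rewrite -mulr_suml; apply/eqP; rewrite subr_eq0; apply/eqP.
apply: (mulfI p_neq0); rewrite mulrA sum_q !mulfV //.
by rewrite pnatr_eq0 -lt0n expn_gt0 p_gt0.
Qed.
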